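(* Let $r(s)=\left(4\cos\frac{s}{4},\,4\sin\frac{s}{4},\,0\right)$, $s\in\mathbb{R}$. For every $c\in[-1,1]$ and each of the two choices of sign $\varepsilon\in\{1,-1\}$, the parametrized surface $$x(s,t)=\left(\rho(t)\cos\tfrac{s}{4},\ \rho(t)\sin\tfrac{s}{4},\ ct\right),\qquad \rho(t)=2\left(\left(1-\varepsilon\sqrt{1-c^2}\right)e^{t/4}+\left(1+\varepsilon\sqrt{1-c^2}\right)e^{-t/4}\right),$$ $(s,t)\in\mathbb{R}^2$, is a minimal surface passing through the circle $r$, with $x(s,0)=r(s)$ for all $s$.
   Context: A surface is minimal if its mean curvature vanishes everywhere. *)

(* Defs.v *)
(* Stdlib reals, with Coquelicot for derivatives. *)
From Stdlib Require Export Reals.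
From Coquelicot Require Export Coquelicot.
Open Scope R_scope.

Definition vec3 : Type := (R * R * R)%type.

Definition c1 (v : vec3) : R := fst (fst v).
Definition c2 (v : vec3) : R := snd (fst v).
Definition c3 (v : vec3) : R := snd v.

Definition dot (u v : vec3) : R := c1 u * c1 v + c2 u * c2 v + c3 u * c3 v.

Definition cross (u v : vec3) : vec3 :=
  (c2 u * c3 v - c3 u * c2 v,
   c3 u * c1 v - c1 u * c3 v,
   c1 u * c2 v - c2 u * c1 v).

Definition norm3 (v : vec3) : R := sqrt (dot v v).

Definition scal3 (a : R) (v : vec3) : vec3 := (a * c1 v, a * c2 v, a * c3 v).

(* A surface parametrized over the whole plane; the type does not impose
   smoothness or regularity, see [regular_surface]. *)
Definition psurface : Type := R -> R -> vec3.

Definition D_s (x : psurface) : psurface := fun s t =>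
  (Derive (fun u => c1 (x u t)) s,
   Derive (fun u => c2 (x u t)) s,
   Derive (fun u => c3 (x u t)) s).

Definition D_t (x : psurface) : psurface := fun s t =>
  (Derive (fun v => c1 (x s v)) t,
   Derive (fun v => c2 (x s v)) t,
   Derive (fun v => c3 (x s v)) t).

(* C^infinity: [ex_diff_n f n s t] says that all partial derivatives of [f] of
   order at most [n] exist and are continuous at [(s, t)]. *)
Definition smooth2 (f : R -> R -> R) : Prop :=
  forall (n : nat) (s t : R), ex_diff_n f n s t.

Definition regular_surface (x : psurface) : Prop :=
  smooth2 (fun s t => c1 (x s t)) /\
  smooth2 (fun s t => c2 (x s t)) /\
  smooth2 (fun s t => c3 (x s t)) /\
  forall s t : R, cross (D_s x s t) (D_t x s t) <> (0, 0, 0).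

Definition unit_normal (x : psurface) : psurface := fun s t =>
  let w := cross (D_s x s t) (D_t x s t) in scal3 (/ norm3 w) w.

(* Coefficients of the first ([ffE], [ffF], [ffG]) and second
   ([sfe], [sff], [sfg]) fundamental forms. *)
Definition ffE (x : psurface) (s t : R) : R := dot (D_s x s t) (D_s x s t).
Definition ffF (x : psurface) (s t : R) : R := dot (D_s x s t) (D_t x s t).
Definition ffG (x : psurface) (s t : R) : R := dot (D_t x s t) (D_t x s t).

Definition sfe (x : psurface) (s t : R) : R :=
  dot (D_s (D_s x) s t) (unit_normal x s t).
Definition sff (x : psurface) (s t : R) : R :=
  dot (D_t (D_s x) s t) (unit_normal x s t).
Definition sfg (x : psurface) (s t : R) : R :=
  dot (D_t (D_t x) s t) (unit_normal x s t).

(* Half the trace of the shape operator; the denominator is nonzero when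
   [regular_surface x] holds. *)
Definition mean_curvature (x : psurface) (s t : R) : R :=
  (sfe x s t * ffG x s t - 2 * sff x s t * ffF x s t + sfg x s t * ffE x s t)
  / (2 * (ffE x s t * ffG x s t - ffF x s t ^ 2)).

Definition minimal_surface (x : psurface) : Prop :=
  regular_surface x /\ forall s t : R, mean_curvature x s t = 0.

Definition passes_through (x : psurface) (r : R -> vec3) : Prop :=
  forall s : R, exists u v : R, x u v = r s.

Definition circle_r (s : R) : vec3 := (4 * cos (s / 4), 4 * sin (s / 4), 0).

Definition rho (c eps t : R) : R :=
  2 * ((1 - eps * sqrt (1 - c ^ 2)) * exp (t / 4)
       + (1 + eps * sqrt (1 - c ^ 2)) * exp (- t / 4)).

Definition surface_x (c eps : R) : psurface := fun s t =>
  (rho c eps t * cos (s / 4), rho c eps t * sin (s / 4), c * t).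

(* Main.v *)
Require Import Defs.
From Stdlib Require Import Reals Lra FunctionalExtensionality.
From Coquelicot Require Import Coquelicot.
(* [Reals] shadows the projection [c1] of [Defs]. *)
Import Defs.
Open Scope R_scope.

(** With [A = 1 - eps * sqrt (1 - c^2)] and [B = 1 + eps * sqrt (1 - c^2)] one
    has [A * B = c^2], so the profile [rho = 2 (A e^(t/4) + B e^(-t/4))]
    satisfies [rho'' = rho / 16] and [rho^2 = 16 (rho'^2 + c^2)]. For the surface
    of revolution with this profile, these give [E = G], [F = 0] and
    [e = - g], hence mean curvature zero. *)

(* Functions with [p'' = k p] are closed under differentiation, which makes the
   induction on the order of differentiation go through. *)
Lemma smooth2_mult_second_order_ode (p p' q q' : R -> R) (k l : R) :
  (forall s, is_derive p s (p' s)) -> (forall s, is_derive p' s (k * p s)) ->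
  (forall t, is_derive q t (q' t)) -> (forall t, is_derive q' t (l * q t)) ->
  smooth2 (fun s t => p s * q t).
Proof.
intros Hp Hp' Hq Hq' n; revert p p' q q' Hp Hp' Hq Hq'.
induction n as [|n IH]; intros p p' q q' Hp Hp' Hq Hq' s t.
(* [ex_diff_n] demands continuity at every order, including 0, so both cases of the induction need
   it. *)
all: assert (Hc : continuity_2d_pt (fun u v => p u * q v) s t)
  by (apply continuity_2d_pt_mult;
      [ apply continuity_1d_2d_pt_comp with (g := fun u _ => u);
        [ apply continuity_pt_filterlim, @ex_derive_continuous; eexists; apply Hp
        | apply continuity_2d_pt_id1 ]
      | apply continuity_1d_2d_pt_comp with (g := fun _ v => v);
        [ apply continuity_pt_filterlim, @ex_derive_continuous; eexists; apply Hq
        | apply continuity_2d_pt_id2 ] ]).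
{ split; [exact Hc | exact I]. }
assert (Ds : forall u v, is_derive (fun z => p z * q v) u (p' u * q v)).
{ intros u v; apply @is_derive_scal_l with (V := R_NormedModule); apply Hp. }
assert (Dt : forall u v, is_derive (fun z => p u * q z) v (p u * q' v)).
{ intros u v; apply is_derive_scal, Hq. }
split; [exact Hc | split; [| split; [| split]]].
- eexists; apply Ds.
- eexists; apply Dt.
- replace (fun u v => Derive (fun z => p z * q v) u)
    with (fun u v => p' u * q v).
  + apply IH with (p' := fun u => k * p u) (q' := q'); auto.
    intros u; apply is_derive_scal, Hp.
  + do 2 (apply functional_extensionality; intro).
    symmetry; apply is_derive_unique, Ds.
- replace (fun u v => Derive (fun z => p u * q z) v)
    with (fun u v => p u * q' v).
  + apply IH with (p' := p') (q' := fun v => l * q v); auto.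
    intros v; apply is_derive_scal, Hq.
  + do 2 (apply functional_extensionality; intro).
    symmetry; apply is_derive_unique, Dt.
Qed.

(** The conclusion equates functions rather than values, so it can be rewritten under a further
    [D_s] or [D_t]. *)
Lemma is_derive_D_s (x y : psurface) :
  (forall s t, is_derive (fun u => c1 (x u t)) s (c1 (y s t))) ->
  (forall s t, is_derive (fun u => c2 (x u t)) s (c2 (y s t))) ->
  (forall s t, is_derive (fun u => c3 (x u t)) s (c3 (y s t))) ->
  D_s x = y.
Proof.
intros H1 H2 H3; do 2 (apply functional_extensionality; intro).
unfold D_s; erewrite !is_derive_unique by auto.
now destruct (y _ _) as [[? ?] ?].
Qed.

Lemma is_derive_D_t (x y : psurface) :
  (forall s t, is_derive (fun v => c1 (x s v)) t (c1 (y s t))) ->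
  (forall s t, is_derive (fun v => c2 (x s v)) t (c2 (y s t))) ->
  (forall s t, is_derive (fun v => c3 (x s v)) t (c3 (y s t))) ->
  D_t x = y.
Proof.
intros H1 H2 H3; do 2 (apply functional_extensionality; intro).
unfold D_t; erewrite !is_derive_unique by auto.
now destruct (y _ _) as [[? ?] ?].
Qed.

(** * Surfaces of revolution with profile [r] about the third axis *)

Section Revolution.

Variables (r r' r'' : R -> R) (c : R).
Hypothesis Dr : forall t, is_derive r t (r' t).
Hypothesis Dr' : forall t, is_derive r' t (r'' t).

Let x : psurface := fun s t => (r t * cos (s / 4), r t * sin (s / 4), c * t).

(* The eta-expanded form is the one that [auto_derive] leaves in its goals. *)
Let Er (t : R) : Derive (fun v => r v) t = r' t :=
  is_derive_unique _ _ _ (Dr t).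
Let Er' (t : R) : Derive (fun v => r' v) t = r'' t :=
  is_derive_unique _ _ _ (Dr' t).

Lemma D_s_revolution :
  D_s x = fun s t => (- (r t / 4) * sin (s / 4), r t / 4 * cos (s / 4), 0).
Proof.
apply is_derive_D_s; intros s t; unfold x, c1, c2, c3; simpl;
  auto_derive; trivial; unfold Rdiv; ring.
Qed.

Lemma D_t_revolution :
  D_t x = fun s t => (r' t * cos (s / 4), r' t * sin (s / 4), c).
Proof.
apply is_derive_D_t; intros s t; unfold x, c1, c2, c3; simpl;
  auto_derive; try (eexists; apply Dr); trivial;
  try rewrite Er; ring.
Qed.

Lemma D_ss_revolution :
  D_s (D_s x) =
  fun s t => (- (r t / 16) * cos (s / 4), - (r t / 16) * sin (s / 4), 0).
Proof.
rewrite D_s_revolution.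
apply is_derive_D_s; intros s t; unfold c1, c2, c3; simpl;
  auto_derive; trivial; unfold Rdiv; field.
Qed.

Lemma D_ts_revolution :
  D_t (D_s x) =
  fun s t => (- (r' t / 4) * sin (s / 4), r' t / 4 * cos (s / 4), 0).
Proof.
rewrite D_s_revolution.
apply is_derive_D_t; intros s t; unfold c1, c2, c3; simpl;
  auto_derive; try (eexists; apply Dr); trivial;
  try rewrite Er; field.
Qed.

Lemma D_tt_revolution :
  D_t (D_t x) = fun s t => (r'' t * cos (s / 4), r'' t * sin (s / 4), 0).
Proof.
rewrite D_t_revolution.
apply is_derive_D_t; intros s t; unfold c1, c2, c3; simpl;
  auto_derive; try (eexists; apply Dr'); trivial;
  try rewrite Er'; ring.
Qed.

Lemma cross_revolution (s t : R) :
  cross (D_s x s t) (D_t x s t) =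
  (r t / 4 * c * cos (s / 4), r t / 4 * c * sin (s / 4), - (r t * r' t / 4)).
Proof.
rewrite D_s_revolution, D_t_revolution; unfold cross, c1, c2, c3; simpl.
pose proof (sin2_cos2 (s / 4)) as Hsc; unfold Rsqr in Hsc.
f_equal; [f_equal; ring |].
transitivity (- (r t * r' t / 4)
  * (sin (s / 4) * sin (s / 4) + cos (s / 4) * cos (s / 4)));
  [| rewrite Hsc]; field.
Qed.

(** The first two components are [r t / 4 * c] times the cosine and sine of one angle, which cannot
    both vanish; this settles [c <> 0]. If [r' t <> 0], the third component is nonzero. *)
Lemma cross_revolution_neq0 (s t : R) :
  r t <> 0 -> (c <> 0 \/ r' t <> 0) ->
  cross (D_s x s t) (D_t x s t) <> (0, 0, 0).
Proof.
rewrite cross_revolution; intros Hr Hcr H; injection H as H1 H2 H3.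
pose proof (sin2_cos2 (s / 4)) as Hsc; unfold Rsqr in Hsc.
destruct Hcr as [Hc | Hr'].
- assert (Hrc : r t / 4 * c <> 0)
    by (apply Rmult_integral_contrapositive_currified; lra).
  apply Rmult_integral in H1; apply Rmult_integral in H2.
  destruct H1 as [H1 | H1]; [easy |]; destruct H2 as [H2 | H2]; [easy |].
  rewrite H1, H2 in Hsc; lra.
- apply (Rmult_integral_contrapositive_currified (r t) (r' t)); lra.
Qed.

Lemma mean_curvature_revolution (s t : R) :
  r'' t = r t / 16 -> r t ^ 2 = 16 * (r' t ^ 2 + c ^ 2) ->
  mean_curvature x s t = 0.
Proof.
intros Hode Hint.
pose proof (sin2_cos2 (s / 4)) as Hsc; unfold Rsqr in Hsc.
assert (HE : ffE x s t = r t ^ 2 / 16).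
{ unfold ffE; rewrite D_s_revolution; unfold dot, c1, c2, c3; simpl.
  transitivity (r t ^ 2 / 16
    * (sin (s / 4) * sin (s / 4) + cos (s / 4) * cos (s / 4)));
    [field | rewrite Hsc; field]. }
assert (HF : ffF x s t = 0).
{ unfold ffF; rewrite D_s_revolution, D_t_revolution.
  unfold dot, c1, c2, c3; simpl; field. }
assert (HG : ffG x s t = r t ^ 2 / 16).
{ unfold ffG; rewrite D_t_revolution, Hint; unfold dot, c1, c2, c3; simpl.
  transitivity (r' t ^ 2
    * (sin (s / 4) * sin (s / 4) + cos (s / 4) * cos (s / 4)) + c ^ 2);
    [ring | rewrite Hsc; field]. }
(* By the differential equation the second [t]-derivative is [r t / 16] times the radial vector, the
   opposite of the second [s]-derivative; both are paired with the same normal. *)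
assert (Heg : sfe x s t = - sfg x s t).
{ unfold sfe, sfg, unit_normal; rewrite D_ss_revolution, D_tt_revolution.
  rewrite cross_revolution, Hode.
  set (m := / norm3 _); unfold dot, scal3, c1, c2, c3; simpl; field. }
unfold mean_curvature; rewrite HE, HF, HG, Heg.
(* With [E = G], [F = 0] and [e = - g] the numerator cancels. *)
unfold Rdiv at 1; apply Rmult_eq_0_compat_r; ring.
Qed.

End Revolution.

(** * The profile [rho]: differential equation, first integral, positivity *)

Definition rho' (c eps t : R) : R :=
  / 2 * ((1 - eps * sqrt (1 - c ^ 2)) * exp (t / 4)
         - (1 + eps * sqrt (1 - c ^ 2)) * exp (- t / 4)).

Lemma is_derive_rho (c eps t : R) : is_derive (rho c eps) t (rho' c eps t).
Proof.
(* The root is constant in [t]; behind a variable it stays out of the differentiation. *)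
unfold rho, rho'; generalize (sqrt (1 - c ^ 2)); intro a.
auto_derive; trivial; unfold Rdiv; field.
Qed.

Lemma is_derive_rho' (c eps t : R) :
  is_derive (rho' c eps) t (/ 16 * rho c eps t).
Proof.
unfold rho, rho'; generalize (sqrt (1 - c ^ 2)); intro a.
auto_derive; trivial; unfold Rdiv; field.
Qed.

Section Profile.

Variables c eps : R.
Hypothesis hc : -1 <= c <= 1.
Hypothesis heps : eps = 1 \/ eps = -1.

Lemma eps_sqrt_sqr : (eps * sqrt (1 - c ^ 2)) ^ 2 = 1 - c ^ 2.
Proof.
rewrite Rpow_mult_distr, pow2_sqrt by nra.
destruct heps; subst eps; ring.
Qed.

(** With [u], [v] the two exponentials, [rho^2 - 16 rho'^2 = 4 ((A u + B v)^2 - (A u - B v)^2) = 16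
    A B u v], where [u v = 1] and [A B = 1 - a^2 = c^2]. *)
Lemma rho_first_integral (t : R) :
  rho c eps t ^ 2 = 16 * (rho' c eps t ^ 2 + c ^ 2).
Proof.
pose proof eps_sqrt_sqr as Ha; unfold rho, rho'.
set (a := eps * _) in *.
assert (He : exp (t / 4) * exp (- t / 4) = 1).
{ rewrite <- exp_plus, <- exp_0; f_equal; field. }
set (u := exp (t / 4)) in *; set (v := exp (- t / 4)) in *.
replace (c ^ 2) with ((1 - a ^ 2) * (u * v)) by (rewrite He, Ha; ring).
field.
Qed.

(** The weights [1 - a] and [1 + a] are nonnegative because [a^2 = 1 - c^2 <= 1]. They sum to 2, so
    one is positive; the sign of [a] tells which. *)
Lemma rho_pos (t : R) : 0 < rho c eps t.
Proof.
pose proof eps_sqrt_sqr as Ha; unfold rho; set (a := eps * _) in *.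
pose proof (exp_pos (t / 4)); pose proof (exp_pos (- t / 4)).
assert (-1 <= a <= 1) by (pose proof (pow2_ge_0 c); split; nra).
assert (0 <= (1 - a) * exp (t / 4)) by (apply Rmult_le_pos; lra).
assert (0 <= (1 + a) * exp (- t / 4)) by (apply Rmult_le_pos; lra).
destruct (Rle_lt_dec a 0).
- assert (0 < (1 - a) * exp (t / 4)) by (apply Rmult_lt_0_compat; lra); lra.
- assert (0 < (1 + a) * exp (- t / 4)) by (apply Rmult_lt_0_compat; lra); lra.
Qed.

(** If [c] and [rho'] both vanished, the first integral would force [rho = 0]. For [c = 0] the
    surface is a punctured plane. *)
Lemma profile_immersed (t : R) : c <> 0 \/ rho' c eps t <> 0.
Proof.
destruct (Req_dec c 0) as [Hc | Hc]; [right | now left]; intro H.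
pose proof (rho_first_integral t) as Hi.
pose proof (pow_lt _ 2 (rho_pos t)) as Hp.
rewrite Hi, H, Hc in Hp; lra.
Qed.

End Profile.

(** * Regularity of the surface, the initial circle, and the conclusion *)

Lemma is_derive_cos_4 (s : R) :
  is_derive (fun u => cos (u / 4)) s (- / 4 * sin (s / 4)).
Proof. auto_derive; trivial; unfold Rdiv; field. Qed.

Lemma is_derive_sin_4 (s : R) :
  is_derive (fun u => sin (u / 4)) s (/ 4 * cos (s / 4)).
Proof. auto_derive; trivial; unfold Rdiv; field. Qed.

(** Each coordinate separates into a function of [s] times one of [t], both solving [p'' = k p]:
    [k = - / 16] for the trigonometric factors, [/ 16] for [rho]. *)
Lemma regular_surface_x (c eps : R) :
  -1 <= c <= 1 -> eps = 1 \/ eps = -1 -> regular_surface (surface_x c eps).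
Proof.
intros hc heps; split; [| split; [| split]].
- replace (fun s t => c1 (surface_x c eps s t))
    with (fun s t => cos (s / 4) * rho c eps t)
    by (do 2 (apply functional_extensionality; intro); apply Rmult_comm).
  apply smooth2_mult_second_order_ode with
    (p' := fun s => - / 4 * sin (s / 4)) (k := - / 16)
    (q' := rho' c eps) (l := / 16).
  + apply is_derive_cos_4.
  + intro; auto_derive; trivial; unfold Rdiv; field.
  + apply is_derive_rho.
  + apply is_derive_rho'.
- replace (fun s t => c2 (surface_x c eps s t))
    with (fun s t => sin (s / 4) * rho c eps t)
    by (do 2 (apply functional_extensionality; intro); apply Rmult_comm).
  apply smooth2_mult_second_order_ode with
    (p' := fun s => / 4 * cos (s / 4)) (k := - / 16)
    (q' := rho' c eps) (l := / 16).
  + apply is_derive_sin_4.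
  + intro; auto_derive; trivial; unfold Rdiv; field.
  + apply is_derive_rho.
  + apply is_derive_rho'.
(* The height is the constant [c] times the identity, both with zero second derivative. *)
- apply (smooth2_mult_second_order_ode (fun _ => c) (fun _ => 0)
    (fun t => t) (fun _ => 1) 0 0); intro; auto_derive; trivial; ring.
- intros s t.
  apply (cross_revolution_neq0 _ _ _ (is_derive_rho c eps)).
  + now apply Rgt_not_eq, rho_pos.
  + now apply profile_immersed.
Qed.

Lemma surface_x_0 (c eps s : R) : surface_x c eps s 0 = circle_r s.
Proof.
assert (H : rho c eps 0 = 4).
{ unfold rho; replace (- 0 / 4) with 0 by field.
  replace (0 / 4) with 0 by field; rewrite exp_0; ring. }
unfold surface_x, circle_r; rewrite H, Rmult_0_r; reflexivity.
Qed.

Theorem mainTheorem2 (c eps : R) (hc : -1 <= c <= 1) (heps : eps = 1 \/ eps = -1) :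
  minimal_surface (surface_x c eps) /\
  passes_through (surface_x c eps) circle_r /\
  (forall s : R, surface_x c eps s 0 = circle_r s).
Proof.
split; [split | split].
- now apply regular_surface_x.
- intros s t.
  apply (mean_curvature_revolution _ _ _ _ (is_derive_rho c eps)
    (is_derive_rho' c eps)).
  + apply Rmult_comm.
  + now apply rho_first_integral.
- intro s; exists s, 0; apply surface_x_0.
- apply surface_x_0.
Qed.
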